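(* (i) The images in $\mathrm{gr}^{W,L}_{5,3}(\mathcal{MD}^{adm})$ of the admissible brackets of weight $5$ and length $3$ satisfy at least one nontrivial $\mathbb{Q}$-linear relation. (ii) The images in $\mathrm{gr}^{W,L}_{6,3}(\mathcal{MD}^{adm})$ of the admissible brackets of weight $6$ and length $3$ satisfy at least $3$ linearly independent $\mathbb{Q}$-linear relations.
   Context: For integers $r_1,\dots,r_l\ge 0$ and $n\ge 1$ let $\sigma_{r_1,\dots,r_l}(n)=\sum v_1^{r_1}\cdots v_l^{r_l}$, summed over positive integers $u_1>\dots>u_l>0$, $v_1,\dots,v_l>0$ with $u_1v_1+\dots+u_lv_l=n$. For integers $s_1,\dots,s_l\ge1$ the bracket is $[s_1,\dots,s_l]=\frac{1}{(s_1-1)!\cdots(s_l-1)!}\sum_{n>0}\sigma_{s_1-1,\dots,s_l-1}(n)q^n\in\mathbb{Q}[[q]]$, of weight $s_1+\dots+s_l$ and length $l$ ($1$ has weight and length $0$). A bracket is admissible if $s_1>1$. $\mathcal{MD}^{adm}$ is the $\mathbb{Q}$-span of $1$ and all admissible brackets, $\mathrm{Fil}^{W,L}_{k,l}(\mathcal{MD}^{adm})$ the span of $1$ and admissible brackets of weight $\le k$ and length $\le l$, and $\mathrm{gr}^{W,L}_{k,l}(\mathcal{MD}^{adm})=\mathrm{Fil}^{W,L}_{k,l}(\mathcal{MD}^{adm})\big/\big(\mathrm{Fil}^{W,L}_{k-1,l}(\mathcal{MD}^{adm})+\mathrm{Fil}^{W,L}_{k,l-1}(\mathcal{MD}^{adm})\big)$.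 *)

(* Defs.v *)
From HB Require Import structures.
From mathcomp Require Import all_boot all_order all_algebra.
From mathcomp Require Import boolp functions.

Set Implicit Arguments.
Unset Strict Implicit.
Unset Printing Implicit Defensive.

Import Order.TTheory GRing.Theory Num.Theory.
Local Open Scope ring_scope.

Section Span.
Variables (K : pzRingType) (V : lmodType K).

Definition span (G : V -> Prop) : {pred V} := fun x =>
  `[< exists (n : nat) (a : 'I_n -> K) (g : 'I_n -> V),
        (forall i, G (g i)) /\ x = \sum_(i < n) a i *: g i >].

Lemma span_gen (G : V -> Prop) (x : V) : G x -> x \in span G.
Proof.
move=> Gx; apply/asboolP; exists 1%N, (fun=> 1), (fun=> x); split=> //.
by rewrite big_ord1 scale1r.
Qed.

Fact span_submod_closed (G : V -> Prop) : submod_closed (span G).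
Proof.
split.
  apply/asboolP; exists 0%N, (fun=> 0), (fun=> 0); split; first by case.
  by rewrite big_ord0.
move=> c x y /asboolP[n [a [g [Gg ->]]]] /asboolP[m [b [h [Gh ->]]]].
apply/asboolP; exists (n + m)%N.
exists (fun i => match fintype.split i with inl j => c * a j | inr j => b j end).
exists (fun i => match fintype.split i with inl j => g j | inr j => h j end).
split; first by move=> i; case: (fintype.split i).
rewrite big_split_ord scaler_sumr; congr (_ + _); apply: eq_bigr => i _.
  by rewrite (unsplitK (inl i)) scalerA.
by rewrite (unsplitK (inr i)).
Qed.

HB.instance Definition _ (G : V -> Prop) :=
  GRing.isSubmodClosed.Build K V (span G) (span_submod_closed G).

End Span.

(* [Quotient.quot] is only a group; the scalar action of V descends to it. *)
Section LmodQuotient.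
Variables (K : pzRingType) (V : lmodType K) (S : submodClosed V).
Local Open Scope quotient_scope.

(* A submodClosed predicate does not carry closure under opposite, which the
   quotient construction requires. *)
Definition submod_pred : {pred V} := S.
HB.instance Definition _ :=
  GRing.isSubmodClosed.Build K V submod_pred (submodClosedP S).

Definition lmod_quot : Type := Quotient.quot submod_pred.
HB.instance Definition _ := GRing.Zmodule.on lmod_quot.

Definition quot_proj (x : V) : lmod_quot := \pi_(Quotient.quot submod_pred) x.
Definition quot_scale (a : K) (x : lmod_quot) : lmod_quot :=
  quot_proj (a *: repr (x : Quotient.quot submod_pred)).

Lemma quot_projP (x y : V) : (quot_proj x = quot_proj y) <-> (x - y \in S).
Proof. by rewrite -[S : {pred V}]/submod_pred Quotient.idealrBE; split=> [/eqP|/eqP]. Qed.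

Lemma quot_proj_surj (x : lmod_quot) : exists y, x = quot_proj y.
Proof. by exists (repr (x : Quotient.quot submod_pred)); rewrite /quot_proj reprK. Qed.

Lemma quot_projD (x y : V) : quot_proj (x + y) = quot_proj x + quot_proj y.
Proof. exact: (raddfD (\pi_(Quotient.quot submod_pred))). Qed.

Lemma quot_proj0 : quot_proj 0 = 0.
Proof. exact: (raddf0 (\pi_(Quotient.quot submod_pred))). Qed.

Lemma quot_scaleE (a : K) (x : V) :
  quot_scale a (quot_proj x) = quot_proj (a *: x).
Proof.
apply/quot_projP; rewrite -scalerBr rpredZ //; apply/quot_projP.
by rewrite /quot_proj reprK.
Qed.

Fact quot_scalerA a b x : quot_scale a (quot_scale b x) = quot_scale (a * b) x.
Proof. by have [y ->] := quot_proj_surj x; rewrite !quot_scaleE scalerA. Qed.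
Fact quot_scale1r : left_id 1 quot_scale.
Proof.
by move=> x; have [y ->] := quot_proj_surj x; rewrite quot_scaleE scale1r.
Qed.
Fact quot_scalerDr : right_distributive quot_scale +%R.
Proof.
move=> a x y; have [[x' ->] [y' ->]] := (quot_proj_surj x, quot_proj_surj y).
by rewrite -quot_projD !quot_scaleE scalerDr quot_projD.
Qed.
Fact quot_scalerDl x : {morph quot_scale^~ x : a b / a + b}.
Proof.
move=> a b /=; have [y ->] := quot_proj_surj x.
by rewrite !quot_scaleE scalerDl quot_projD.
Qed.

HB.instance Definition _ := GRing.Zmodule_isLmodule.Build K lmod_quot
  quot_scalerA quot_scale1r quot_scalerDr quot_scalerDl.

Fact quot_proj_is_linear : linear quot_proj.
Proof. by move=> a x y; rewrite quot_projD -quot_scaleE. Qed.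

HB.instance Definition _ :=
  GRing.isLinear.Build K V lmod_quot *:%R quot_proj quot_proj_is_linear.

Lemma quot_proj_eq0 (x : V) : (quot_proj x = 0) <-> (x \in S).
Proof. by rewrite -quot_proj0 quot_projP subr0. Qed.

End LmodQuotient.

(* The Q-vector space Q[[q]]: a series is its sequence of coefficients. The
   pointwise product and unit carried by this type are not those of Q[[q]]. *)
Definition qseries : Type := nat -> rat^o.
HB.instance Definition _ := GRing.Lmodule.on qseries.

Definition qone : qseries := fun n => (n == 0%N)%:R.

(* For n >= 1 every u_i and v_i satisfies u_i, v_i <= u_i v_i <= n, so letting
   them range over {0, ..., n} loses no term. *)
Definition sigma (r : seq nat) (n : nat) : nat :=
  (\sum_(u : {ffun 'I_(size r) -> 'I_n.+1} |
           [forall i, 0 < u i] &&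
           [forall i : 'I_(size r), forall j : 'I_(size r), (i < j) ==> (u j < u i)])
    \sum_(v : {ffun 'I_(size r) -> 'I_n.+1} |
           [forall i, 0 < v i] && (\sum_i u i * v i == n))
      \prod_i v i ^ nth 0 r i)%N.

Definition bracket (s : seq nat) : qseries := fun n =>
  if (0 < n)%N
  then (\prod_(x <- s) (x.-1)`!)%N%:R^-1 * (sigma [seq x.-1 | x <- s] n)%:R
  else 0.

Definition admissible (s : seq nat) : bool :=
  all (fun x => 0 < x)%N s && (1 < head 0 s)%N.

(* Integer bounds make Fil_{-1,l} and Fil_{k,-1} the zero space; the series 1
   has weight and length 0. *)
Definition Fil_gen (k l : int) (f : qseries) : Prop :=
  (0 <= k /\ 0 <= l /\ f = qone) \/
  (exists s : seq nat,
     [/\ admissible s, (sumn s)%:Z <= k, (size s)%:Z <= l & f = bracket s]).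

Definition Fil (k l : int) : {pred qseries} := span (Fil_gen k l).
HB.instance Definition _ (k l : int) := GRing.SubmodClosed.on (Fil k l).

Definition FilT (k l : int) : Type := {f : qseries | f \in Fil k l}.
HB.instance Definition _ (k l : int) := [isSub of FilT k l for @sval _ _].
HB.instance Definition _ (k l : int) := [Choice of FilT k l by <:].
HB.instance Definition _ (k l : int) :=
  [SubChoice_isSubLmodule of FilT k l by <:].

Definition Fil_lower (k l : int) : {pred FilT k l} := fun f =>
  `[< exists g h : qseries,
        [/\ g \in Fil (k - 1) l, h \in Fil k (l - 1) & val f = g + h] >].

Fact Fil_lower_submod_closed (k l : int) : submod_closed (@Fil_lower k l).
Proof.
split.
  by apply/asboolP; exists 0, 0; rewrite !rpred0 addr0 linear0.
move=> a x y /asboolP[g [h [Fg Fh Dx]]] /asboolP[g' [h' [Fg' Fh' Dy]]].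
apply/asboolP; exists (a *: g + g'), (a *: h + h'); split.
- by rewrite rpredD ?rpredZ.
- by rewrite rpredD ?rpredZ.
by rewrite linearP /= Dx Dy scalerDr addrACA.
Qed.

HB.instance Definition _ (k l : int) :=
  GRing.isSubmodClosed.Build rat (FilT k l) (@Fil_lower k l)
    (Fil_lower_submod_closed k l).

Definition gr (k l : int) : Type := lmod_quot (@Fil_lower k l).
HB.instance Definition _ (k l : int) := GRing.Lmodule.on (gr k l).

(* The (finitely many) admissible indices of weight k and length l; no entry
   exceeds the weight k. *)
Definition adm_index (k l : nat) : Type :=
  {s : l.-tuple 'I_k.+1 |
    admissible (map val s) && (sumn (map val s) == k)}.
HB.instance Definition _ (k l : nat) := Finite.on (adm_index k l).

Definition index_seq (k l : nat) (s : adm_index k l) : seq nat :=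
  map val (val s).

Lemma bracket_Fil (k l : nat) (s : adm_index k l) :
  bracket (index_seq s) \in Fil k l.
Proof.
apply: span_gen; right; exists (index_seq s).
case: s => s; rewrite /index_seq /= => /andP[adm_s /eqP wt_s].
by rewrite wt_s size_map size_tuple.
Qed.

Definition gr_bracket (k l : nat) (s : adm_index k l) : gr k l :=
  quot_proj (@Fil_lower k l) (Sub (bracket (index_seq s)) (bracket_Fil s)).

Notation coefs k l := {ffun adm_index k l -> rat^o}.

Definition is_relation (k l : nat) (c : coefs k l) : Prop :=
  \sum_(s : adm_index k l) c s *: gr_bracket s = 0.

(* Main.v *)
Require Import Defs.
From mathcomp Require Import all_boot all_order all_algebra.
From mathcomp Require Import boolp functions zify ring.

Import GRing.Theory Num.Theory.
Local Open Scope ring_scope.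

Set Implicit Arguments.
Unset Strict Implicit.
Unset Printing Implicit Defensive.

(* For a function f of u_1 > ... > u_l > 0 and v_1, ..., v_l > 0, let S_l(f) be
   the series whose n-th coefficient sums f over u_1 v_1 + ... + u_l v_l = n;
   brackets are the case of monomials in the v_i. Two facts generate relations
   between these series. Reading (u, v) as a partition of n and conjugating it
   leaves S_l(f) invariant. A product of S_1 and S_l splits according to the
   position of the first u among the others (stuffle), and conjugating either
   factor before splitting gives a second expression for the same product.
   Taking polynomial f that depend on the u_i as well, suitable combinations
   of these identities contain no u_i and no bracket with s_1 = 1:

     [2,2,1] - 2 [3,1,1],   [3,1,2],   [2,3,1] + [3,2,1] - 3 [2,2,2],
     [2,2,2] + [2,3,1] - 3 [4,1,1]

   lie in the span of admissible brackets of lower weight or length. *)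

(** * Conjugation and products *)

(** The maps [h] and [k] need to be inverse only on the filtered ranges: the bijections below
    involve truncated subtraction and are not invertible elsewhere. *)
Lemma reindex_seq (R : nmodType) (X Y : eqType) (r : seq X) (s : seq Y)
    (P : pred X) (Q : pred Y) (h : X -> Y) (k : Y -> X) (F : X -> R) :
  uniq r -> uniq s ->
  (forall x, x \in r -> P x -> [/\ h x \in s, Q (h x) & k (h x) = x]) ->
  (forall y, y \in s -> Q y -> [/\ k y \in r, P (k y) & h (k y) = y]) ->
  \sum_(x <- r | P x) F x = \sum_(y <- s | Q y) F (k y).
Proof.
move=> Ur Us hP kQ.
rewrite -big_filter -[RHS]big_filter -[RHS](big_map k predT F).
apply: perm_big; apply: uniq_perm.
- by rewrite filter_uniq.
- rewrite map_inj_in_uniq ?filter_uniq // => y z.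
  rewrite !mem_filter => /andP[Qy sy] /andP[Qz sz] Eyz.
  by have [[_ _ <-] [_ _ <-]] := (kQ _ sy Qy, kQ _ sz Qz); rewrite Eyz.
move=> x; apply/idP/mapP; rewrite mem_filter.
  case/andP=> Px rx; have [sh Qh Dx] := hP _ rx Px.
  by exists (h x) => //; rewrite mem_filter Qh.
case=> y; rewrite mem_filter => /andP[Qy sy] ->.
by have [-> -> _] := kQ _ sy Qy.
Qed.

Lemma reindex_involution (R : nmodType) (X : eqType) (r : seq X) (P : pred X)
    (h : X -> X) (F : X -> R) :
  uniq r ->
  (forall x, x \in r -> P x -> [/\ h x \in r, P (h x) & h (h x) = x]) ->
  \sum_(x <- r | P x) F x = \sum_(x <- r | P x) F (h x).
Proof. by move=> Ur hP; apply: (reindex_seq F Ur Ur hP hP). Qed.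

(** * Points and the boxes that enumerate them *)

Definition point := (nat * nat)%type.

Definition area (p : point) : nat := (p.1 * p.2)%N.

(** A point $(u, v)$ stands for $v$ parts of size $u$ in a partition. The box contains every point
    with positive coordinates and area at most [n]. *)
Definition pts (n : nat) : seq point :=
  [seq (u, v) | u <- iota 1 n, v <- iota 1 n].
Definition pts2 (n : nat) : seq (point * point) :=
  [seq (p, q) | p <- pts n, q <- pts n].
Definition pts3 (n : nat) : seq (point * point * point) :=
  [seq (t, r) | t <- pts2 n, r <- pts n].

Lemma pair_uniq (X Y : eqType) (r : seq X) (s : seq Y) :
  uniq r -> uniq s -> uniq [seq (x, y) | x <- r, y <- s].
Proof. by move=> Ur Us; apply: allpairs_uniq => // -[? ?] [? ?]. Qed.

Lemma mem_pair (X Y : eqType) (r : seq X) (s : seq Y) x y :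
  ((x, y) \in [seq (x, y) | x <- r, y <- s]) = (x \in r) && (y \in s).
Proof.
apply/allpairsP/andP => [[[x' y'] /= [rx sy [-> ->]]] //|[rx sy]].
by exists (x, y).
Qed.

Lemma pts_uniq n : uniq (pts n).
Proof. by rewrite pair_uniq ?iota_uniq. Qed.
Lemma pts2_uniq n : uniq (pts2 n).
Proof. by rewrite pair_uniq ?pts_uniq. Qed.
Lemma pts3_uniq n : uniq (pts3 n).
Proof. by rewrite pair_uniq ?pts_uniq ?pts2_uniq. Qed.

Lemma mem_pts n u v : ((u, v) \in pts n) = (0 < u <= n)%N && (0 < v <= n)%N.
Proof. by rewrite mem_pair !mem_iota !add1n !ltnS. Qed.

Lemma mem_pts2 n p q : ((p, q) \in pts2 n) = (p \in pts n) && (q \in pts n).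
Proof. exact: mem_pair. Qed.
Lemma mem_pts3 n t r : ((t, r) \in pts3 n) = (t \in pts2 n) && (r \in pts n).
Proof. exact: mem_pair. Qed.

Lemma sum_allpairs_dep (R : nmodType) (X Y : eqType) (r : seq X) (s : seq Y)
    (P : pred X) (Q : X -> pred Y) (F : X -> Y -> R) :
  \sum_(x <- r | P x) \sum_(y <- s | Q x y) F x y =
  \sum_(t <- [seq (x, y) | x <- r, y <- s] | P t.1 && Q t.1 t.2) F t.1 t.2.
Proof.
rewrite big_mkcond [RHS]big_mkcond big_allpairs; apply: eq_bigr => x _ /=.
by case: (P x); [rewrite big_mkcond | rewrite big1].
Qed.

(** Points $(u, x)$ and $(u, x')$ merge into $(u, x + x')$ without changing the total area;
    conversely $(u, v)$ splits once for each $0 < x < v$. The bound on [m] keeps the merged point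
    inside the box, and [y] carries along whatever else is summed over. *)
Lemma sum_diagonal (R : nmodType) (Y : eqType) (s : seq Y) n
    (P : nat -> nat -> Y -> bool) (f : nat -> nat -> nat -> Y -> R) :
  uniq s -> (forall u m y, P u m y -> (m <= n)%N) ->
  \sum_(t <- [seq (t, y) | t <- pts2 n, y <- s] |
        (t.1.1.1 == t.1.2.1)
        && P t.1.1.1 (area t.1.1 + area t.1.2)%N t.2)
      f t.1.1.1 t.1.1.2 t.1.2.2 t.2 =
  \sum_(z <- [seq (p, y) | p <- pts n, y <- s] | P z.1.1 (area z.1) z.2)
    \sum_(1 <= x < z.1.2) f z.1.1 x (z.1.2 - x)%N z.2.
Proof.
move=> Us leP.
transitivity (\sum_(z <- [seq (p, y) | p <- pts n, y <- s] |
    P z.1.1 (area z.1) z.2)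
      \sum_(x <- iota 1 n | (x < z.1.2)%N) f z.1.1 x (z.1.2 - x)%N z.2).
  rewrite sum_allpairs_dep.
  pose h (t : point * point * Y) : point * Y * nat :=
    (((t.1.1.1, (t.1.1.2 + t.1.2.2)%N), t.2), t.1.1.2).
  pose k (w : point * Y * nat) : point * point * Y :=
    (((w.1.1.1, w.2), (w.1.1.1, (w.1.1.2 - w.2)%N)), w.1.2).
  apply: (reindex_seq (h := h) (k := k)).
  - by rewrite pair_uniq ?pts2_uniq.
  - by rewrite !pair_uniq ?iota_uniq ?pts_uniq.
  - move=> [[[u v] [u' w]] y]; rewrite /h /k /area !mem_pair !mem_iota /=.
    move=> /andP[/andP[u_ w_] sy] /andP[/eqP Du Pu].
    move: u_ w_ Pu; rewrite -{}Du => u_ w_ Pu.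
    have le_n := leP _ _ _ Pu; rewrite mulnDr Pu sy /= addKn; split=> //; nia.
  move=> [[[u v] y] x]; rewrite /h /k /area !mem_pair /= !mem_iota.
  move=> /andP[/andP[uv sy] x_] /andP[Pu x_v].
  have le_n := leP _ _ _ Pu; have le_xv := ltnW x_v.
  rewrite eqxx -mulnDr (subnKC le_xv) sy Pu.
  by split=> //=; nia.
rewrite big_seq_cond [RHS]big_seq_cond; apply: eq_bigr => -[[u v] y] /=.
rewrite mem_pair mem_pts => /andP[/andP[/andP[_ /andP[_ le_vn]] _] _].
by rewrite (big_nat_widen _ _ n.+1) ?leqW // /index_iota subn1.
Qed.

(** * Sums over descending points, their conjugation and products *)

Section Sums.
Variable R : pzRingType.
Implicit Types n : nat.

Definition sum1 n (f : nat -> nat -> R) : R :=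
  \sum_(p <- pts n | area p == n) f p.1 p.2.

Definition desc2 n (t : point * point) : bool :=
  (t.2.1 < t.1.1)%N && (area t.1 + area t.2 == n)%N.
Definition sum2 n (f : nat -> nat -> nat -> nat -> R) : R :=
  \sum_(t <- pts2 n | desc2 n t) f t.1.1 t.1.2 t.2.1 t.2.2.

Definition desc3 n (t : point * point * point) : bool :=
  [&& (t.2.1 < t.1.2.1)%N, (t.1.2.1 < t.1.1.1)%N &
      (area t.1.1 + area t.1.2 + area t.2 == n)%N].
Definition sum3 n (f : nat -> nat -> nat -> nat -> nat -> nat -> R) : R :=
  \sum_(t <- pts3 n | desc3 n t)
    f t.1.1.1 t.1.1.2 t.1.2.1 t.1.2.2 t.2.1 t.2.2.

Lemma sum1_conj n f : sum1 n f = sum1 n (fun u v => f v u).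
Proof.
apply: (reindex_involution (h := fun p => (p.2, p.1)) _ (pts_uniq n)).
case=> u v; rewrite /area !mem_pts /= => /andP[-> ->] /eqP <-.
by rewrite mulnC.
Qed.

(** The partition with $v_1$ parts $u_1$ and $v_2$ parts $u_2$ has as conjugate the one with $u_2$
    parts $v_1 + v_2$ and $u_1 - u_2$ parts $v_1$. Length three is analogous. *)
Lemma sum2_conj n f :
  sum2 n f = sum2 n (fun u1 v1 u2 v2 => f (v1 + v2) u2 v1 (u1 - u2))%N.
Proof.
apply: (reindex_involution (h := fun t =>
   ((t.1.2 + t.2.2, t.2.1), (t.1.2, t.1.1 - t.2.1)))%N _ (pts2_uniq n)).
move=> [[u1 v1] [u2 v2]]; rewrite !mem_pts2 !mem_pts /desc2 /area /=.
move=> ? ?; split; last by congr (_, _, (_, _)); lia.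
all: nia.
Qed.

Lemma sum3_conj n f :
  sum3 n f = sum3 n (fun u1 v1 u2 v2 u3 v3 =>
    f (v1 + v2 + v3) u3 (v1 + v2) (u2 - u3) v1 (u1 - u2))%N.
Proof.
apply: (reindex_involution (h := fun t =>
   ((t.1.1.2 + t.1.2.2 + t.2.2, t.2.1), (t.1.1.2 + t.1.2.2, t.1.2.1 - t.2.1),
    (t.1.1.2, t.1.1.1 - t.1.2.1)))%N _ (pts3_uniq n)).
move=> [[[u1 v1] [u2 v2]] [u3 v3]].
rewrite !mem_pts3 !mem_pts2 !mem_pts /desc3 /area /= => ? ?.
split; last by congr (_, _, (_, _), (_, _)); lia.
all: nia.
Qed.

(** For $f = g(a,b) h(c,d)$ this is the coefficient of a product of two length-one series: the two
    first coordinates are not compared. *)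
Definition prod11 n (f : nat -> nat -> nat -> nat -> R) : R :=
  \sum_(t <- pts2 n | (area t.1 + area t.2 == n)%N)
    f t.1.1 t.1.2 t.2.1 t.2.2.

Lemma prod11_conj n f : prod11 n f = prod11 n (fun a b c d => f b a c d).
Proof.
apply: (reindex_involution (h := fun t => ((t.1.2, t.1.1), t.2))
  _ (pts2_uniq n)).
move=> [[u1 v1] [u2 v2]]; rewrite !mem_pts2 !mem_pts /area /= => ? ?.
by split=> //; lia.
Qed.

(** Stuffle: the first coordinates are decreasing, increasing or equal; in the last case the two
    points merge. *)
Lemma prod11_split n f :
  prod11 n f =
    sum2 n f + sum2 n (fun u1 v1 u2 v2 => f u2 v2 u1 v1)
    + sum1 n (fun u v => \sum_(1 <= x < v) f u x u (v - x)%N).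
Proof.
rewrite /prod11 (bigID (fun t => t.2.1 < t.1.1)%N) /= -addrA; congr (_ + _).
  by apply: eq_bigl => t; rewrite andbC.
rewrite (bigID (fun t => t.1.1 < t.2.1)%N) /=; congr (_ + _).
  apply: (reindex_seq (h := fun t => (t.2, t.1)) (k := fun t => (t.2, t.1)));
    rewrite ?pts2_uniq // => -[[u1 v1] [u2 v2]];
    rewrite !mem_pts2 !mem_pts /desc2 /area /=; move=> ? ?; split=> //; lia.
(* No further point is present, so [sum_diagonal] is used with a dummy factor of type [unit]. *)
pose P (u m : nat) (y : unit) := m == n.
have leP u m y : P u m y -> (m <= n)%N by move=> /eqP->.
transitivity (\sum_(t <- [seq (t, y) | t <- pts2 n, y <- [:: tt]] |
    (t.1.1.1 == t.1.2.1) && P t.1.1.1 (area t.1.1 + area t.1.2)%N t.2)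
      f t.1.1.1 t.1.1.2 t.1.1.1 t.1.2.2).
  rewrite big_mkcond [RHS]big_mkcond big_allpairs; apply: eq_bigr => t _ /=.
  rewrite big_seq1 /P /=; case: (eqVneq t.1.1 t.2.1) => [->|ne_u].
    by rewrite ltnn !andbT.
  by case: ifP => // ?; exfalso; lia.
rewrite (sum_diagonal (fun u x x' _ => f u x u x') _ leP) //.
rewrite /sum1 big_mkcond [RHS]big_mkcond big_allpairs; apply: eq_bigr => t _ /=.
by rewrite big_seq1.
Qed.

(** The analogue of [prod11] for lengths one and two: the first point is free, the other two
    descend. *)
Definition prod12 n (f : nat -> nat -> nat -> nat -> nat -> nat -> R) : R :=
  \sum_(t <- pts3 n | (t.2.1 < t.1.2.1)%N
                      && (area t.1.1 + area t.1.2 + area t.2 == n)%N)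
    f t.1.1.1 t.1.1.2 t.1.2.1 t.1.2.2 t.2.1 t.2.2.

Lemma prod12_conj1 n f :
  prod12 n f = prod12 n (fun a b c d e g => f b a c d e g).
Proof.
apply: (reindex_involution (h := fun t => ((t.1.1.2, t.1.1.1), t.1.2, t.2))
  _ (pts3_uniq n)).
move=> [[[u1 v1] [u2 v2]] [u3 v3]].
rewrite !mem_pts3 !mem_pts2 !mem_pts /area /=.
by move=> ? ?; split=> //; nia.
Qed.

Lemma prod12_conj2 n f :
  prod12 n f =
  prod12 n (fun a b c d e g => f a b (d + g) e d (c - e))%N.
Proof.
apply: (reindex_involution (h := fun t =>
  (t.1.1, (t.1.2.2 + t.2.2, t.2.1), (t.1.2.2, t.1.2.1 - t.2.1)))%N
  _ (pts3_uniq n)).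
move=> [[[u1 v1] [u2 v2]] [u3 v3]].
rewrite !mem_pts3 !mem_pts2 !mem_pts /area /=.
by move=> ? ?; split; last (congr (_, (_, _), (_, _)); lia); nia.
Qed.

(** The five terms are the positions of the free first coordinate relative to the descending pair:
    above both, equal to the larger, strictly between, equal to the smaller, below both. *)
Lemma prod12_split n f :
  prod12 n f =
    sum3 n f
    + (sum2 n (fun u1 v1 u2 v2 =>
         \sum_(1 <= x < v1) f u1 x u1 (v1 - x)%N u2 v2)
    + (sum3 n (fun u1 v1 u2 v2 u3 v3 => f u2 v2 u1 v1 u3 v3)
    + (sum2 n (fun u1 v1 u2 v2 =>
         \sum_(1 <= x < v2) f u2 x u1 v1 u2 (v2 - x)%N)
    + sum3 n (fun u1 v1 u2 v2 u3 v3 => f u3 v3 u1 v1 u2 v2)))).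
Proof.
rewrite /prod12 (bigID (fun t => t.1.2.1 < t.1.1.1)%N) /=; congr (_ + _).
  by apply: eq_bigl => t; rewrite /desc3 -andbA; congr (_ && _); exact: andbC.
rewrite (bigID (fun t => t.1.1.1 == t.1.2.1)%N) /=; congr (_ + _).
  pose P (u m : nat) (y : point) := (y.1 < u)%N && (m + area y == n)%N.
  have leP u m y : P u m y -> (m <= n)%N by rewrite /P; lia.
  rewrite /sum2 -(sum_diagonal (fun u x x' q => f u x u x' q.1 q.2)
    (pts_uniq n) leP).
  apply: eq_big => [t|t /andP[_ /eqP->] //].
  rewrite /P; case: (eqVneq t.1.1.1 t.1.2.1) => [->|_]; rewrite ?andbF // ltnn.
  by rewrite !andbT.
rewrite (bigID (fun t => t.2.1 < t.1.1.1)%N) /=; congr (_ + _).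
  apply: (reindex_seq (h := fun t => (t.1.2, t.1.1, t.2))
                      (k := fun t => (t.1.2, t.1.1, t.2)));
    rewrite ?pts3_uniq // => -[[[u1 v1] [u2 v2]] [u3 v3]];
    rewrite !mem_pts3 !mem_pts2 !mem_pts /desc3 /area /=;
    move=> ? ?; split=> //; lia.
rewrite (bigID (fun t => t.1.1.1 == t.2.1)%N) /=; congr (_ + _).
  pose P (u m : nat) (y : point) := (u < y.1)%N && (m + area y == n)%N.
  have leP u m y : P u m y -> (m <= n)%N by rewrite /P; lia.
  (* The free point collides with the last one, so the last two points are exchanged to bring the
     colliding pair to the front, as [sum_diagonal] expects. *)
  transitivity (\sum_(t <- pts3 n | (t.1.1.1 == t.1.2.1) &&
      P t.1.1.1 (area t.1.1 + area t.1.2)%N t.2)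
      f t.1.1.1 t.1.1.2 t.2.1 t.2.2 t.1.1.1 t.1.2.2).
    rewrite (reindex_seq (s := pts3 n)
      (Q := fun t => (t.1.1.1 == t.1.2.1) &&
        P t.1.1.1 (area t.1.1 + area t.1.2)%N t.2)
      (h := fun t => (t.1.1, t.2, t.1.2)) (k := fun t => (t.1.1, t.2, t.1.2)));
      rewrite ?pts3_uniq //=.
    - by apply: eq_bigr => t /andP[/eqP->].
    - move=> [[[u1 v1] [u2 v2]] [u3 v3]].
      rewrite !mem_pts3 !mem_pts2 !mem_pts /P /area /= => ? ?.
      by split=> //; lia.
    move=> [[[u1 v1] [u2 v2]] [u3 v3]].
    rewrite !mem_pts3 !mem_pts2 !mem_pts /P /area /= => ? ?.
    by split=> //; lia.
  rewrite (sum_diagonal (fun u x x' q => f u x q.1 q.2 u x') (pts_uniq n) leP).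
  (* The merged point has the smaller first coordinate and must come second in [sum2]. *)
  apply: (reindex_seq (h := fun t => (t.2, t.1)) (k := fun t => (t.2, t.1)));
    rewrite ?pts2_uniq // => -[[u1 v1] [u2 v2]];
    rewrite ?mem_pts2 ?mem_pair ?mem_pts /desc2 /P /area /=;
    move=> ? ?; split=> //; lia.
apply: (reindex_seq (h := fun t => (t.1.2, t.2, t.1.1))
                    (k := fun t => (t.2, t.1.1, t.1.2)));
  rewrite ?pts3_uniq // => -[[[u1 v1] [u2 v2]] [u3 v3]];
  rewrite !mem_pts3 !mem_pts2 !mem_pts /desc3 /area /=;
  move=> ? ?; split=> //; lia.
Qed.

End Sums.

(** * Brackets as sums over points *)

Lemma forall_ord_recl n (P : pred 'I_n.+1) :
  [forall i, P i] = P ord0 && [forall i : 'I_n, P (lift ord0 i)].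
Proof.
apply/forallP/andP => [allP|[P0 /forallP allP] i].
  by split=> //; apply/forallP.
by case: (unliftP ord0 i) => [j|] ->.
Qed.

Lemma forall_ord0 (P : pred 'I_0) : [forall i, P i].
Proof. by apply/forallP => -[]. Qed.

(** Inverse direction of the passage from the finite functions of [sigma] to points; [inord] is
    faithful on entries at most [n]. *)
Definition ffun_of n l (s : seq nat) : {ffun 'I_l -> 'I_n.+1} :=
  [ffun i => inord (nth 0%N s (val i))].

Lemma ffun_ofE n l (s : seq nat) (i : 'I_l) :
  (nth 0 s i <= n)%N -> ffun_of n l s i = nth 0%N s i :> nat.
Proof. by move=> le_n; rewrite ffunE inordK. Qed.

Lemma ffun_ofK n l (s : seq nat) (u : {ffun 'I_l -> 'I_n.+1}) :
  (forall i : 'I_l, nth 0%N s i = u i) -> ffun_of n l s = u.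
Proof. by move=> Ds; apply/ffunP => i; rewrite ffunE Ds inord_val. Qed.

Lemma sigma_sum1 (R : pzRingType) n a :
  (sigma [:: a] n)%:R = sum1 n (fun u v => v%:R ^+ a) :> R.
Proof.
rewrite /sigma pair_big_dep /= natr_sum /sum1.
(* The summand is first expressed through the preimage of [p], to fit the shape [F (k y)] of
   [reindex_seq]. *)
have -> : \sum_(p <- pts n | area p == n) p.2%:R ^+ a =
  \sum_(p <- pts n | area p == n)
    (\prod_i ffun_of n 1 [:: p.2] i ^ nth 0 [:: a] i)%N%:R :> R.
  rewrite big_seq_cond [RHS]big_seq_cond; apply: eq_bigr => -[u v] /=.
  rewrite mem_pts => /andP[/andP[_ /andP[_ lev]] _].
  by rewrite big_ord1 ffun_ofE // natrX.
pose T : finType := {ffun 'I_1 -> 'I_n.+1}.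
pose h (t : T * T) : point := (t.1 ord0 : nat, t.2 ord0 : nat).
pose k (p : point) : T * T := (ffun_of n 1 [:: p.1], ffun_of n 1 [:: p.2]).
apply: (@reindex_seq _ (T * T)%type point _ _ _ _ h k
  (fun t => (\prod_i t.2 i ^ nth 0 [:: a] i)%N%:R)).
- exact: index_enum_uniq.
- exact: pts_uniq.
- case=> u v _; rewrite /h /k /= !forall_ord_recl !forall_ord0 big_ord1 /=.
  rewrite ?andbT /area mem_pts => /and3P[u0 v0 Dn].
  rewrite u0 v0 !leq_ord; split=> //=.
  by congr pair; apply: ffun_ofK => i; rewrite (ord1 i).
case=> u v; rewrite /h /k mem_pts /area /=.
case/andP=> /andP[u0 leu] /andP[v0 lev].
rewrite !forall_ord_recl !forall_ord0 big_ord1 /= !ffun_ofE //= u0 v0.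
rewrite ?andbT => ->.
by rewrite mem_index_enum.
Qed.

Lemma sigma_sum2 (R : pzRingType) n a b :
  (sigma [:: a; b] n)%:R =
    sum2 n (fun u1 v1 u2 v2 => v1%:R ^+ a * v2%:R ^+ b) :> R.
Proof.
rewrite /sigma pair_big_dep /= natr_sum /sum2.
pose F (v : {ffun 'I_2 -> 'I_n.+1}) : R :=
  (\prod_i v i ^ nth 0 [:: a; b] i)%N%:R.
have -> : \sum_(t <- pts2 n | desc2 n t) t.1.2%:R ^+ a * t.2.2%:R ^+ b =
  \sum_(t <- pts2 n | desc2 n t) F (ffun_of n 2 [:: t.1.2; t.2.2]).
  rewrite big_seq_cond [RHS]big_seq_cond.
  apply: eq_bigr => -[[u v] [u' v']]; rewrite mem_pts2 !mem_pts.
  case/andP=> /andP[/andP[_ /andP[_ lev]] /andP[_ /andP[_ lev']]] _.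
  by rewrite /F !big_ord_recl big_ord0 /= !ffun_ofE // muln1 natrM !natrX.
pose T : finType := {ffun 'I_2 -> 'I_n.+1}.
pose o1 : 'I_2 := lift ord0 ord0.
pose h (t : T * T) : point * point :=
  ((t.1 ord0 : nat, t.2 ord0 : nat), (t.1 o1 : nat, t.2 o1 : nat)).
pose k (p : point * point) : T * T :=
  (ffun_of n 2 [:: p.1.1; p.2.1], ffun_of n 2 [:: p.1.2; p.2.2]).
apply: (@reindex_seq _ (T * T)%type (point * point)%type _ _ _ _ h k
  (fun t => F t.2)).
- exact: index_enum_uniq.
- exact: pts2_uniq.
- case=> u v _; rewrite /h /k /=.
  rewrite !forall_ord_recl !forall_ord0 !big_ord_recl big_ord0 /=.
  rewrite ?andbT addn0 /desc2 /area mem_pts2 !mem_pts /=.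
  move=> /and3P[/andP[/andP[u0 u1] ->] /andP[v0 v1] ->].
  rewrite u0 v0 u1 v1 !leq_ord; split=> //=.
  congr pair; apply: ffun_ofK => i; case: (unliftP ord0 i) => [j|] -> //;
    by rewrite (ord1 j).
case=> [[u1 v1] [u2 v2]]; rewrite mem_pts2 !mem_pts /h /k /desc2 /area /=.
case/andP=> /andP[/andP[u1_gt0 leu1] /andP[v1_gt0 lev1]].
case/andP=> /andP[u2_gt0 leu2] /andP[v2_gt0 lev2] /andP[lt_u Dn].
rewrite !forall_ord_recl !forall_ord0 !big_ord_recl big_ord0 /=.
by rewrite mem_index_enum !ffun_ofE //= u1_gt0 u2_gt0 v1_gt0 v2_gt0 lt_u addn0.
Qed.

Lemma sigma_sum3 (R : pzRingType) n a b c :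
  (sigma [:: a; b; c] n)%:R =
    sum3 n (fun u1 v1 u2 v2 u3 v3 =>
      v1%:R ^+ a * (v2%:R ^+ b * v3%:R ^+ c)) :> R.
Proof.
rewrite /sigma pair_big_dep /= natr_sum /sum3.
pose F (v : {ffun 'I_3 -> 'I_n.+1}) : R :=
  (\prod_i v i ^ nth 0 [:: a; b; c] i)%N%:R.
have -> : \sum_(t <- pts3 n | desc3 n t)
    t.1.1.2%:R ^+ a * (t.1.2.2%:R ^+ b * t.2.2%:R ^+ c) =
  \sum_(t <- pts3 n | desc3 n t)
    F (ffun_of n 3 [:: t.1.1.2; t.1.2.2; t.2.2]).
  rewrite big_seq_cond [RHS]big_seq_cond.
  apply: eq_bigr => -[[[u1 v1] [u2 v2]] [u3 v3]].
  rewrite mem_pts3 mem_pts2 !mem_pts => /andP[].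
  case/andP=> /andP[/andP[_ /andP[_ lev1]] /andP[_ /andP[_ lev2]]].
  case/andP=> _ /andP[_ lev3] _.
  by rewrite /F !big_ord_recl big_ord0 /= !ffun_ofE // muln1 !natrM !natrX.
pose T : finType := {ffun 'I_3 -> 'I_n.+1}.
pose o1 : 'I_3 := lift ord0 ord0.
pose o2 : 'I_3 := lift ord0 (lift ord0 ord0).
pose h (t : T * T) : point * point * point :=
  ((t.1 ord0 : nat, t.2 ord0 : nat), (t.1 o1 : nat, t.2 o1 : nat),
   (t.1 o2 : nat, t.2 o2 : nat)).
pose k (p : point * point * point) : T * T :=
  (ffun_of n 3 [:: p.1.1.1; p.1.2.1; p.2.1],
   ffun_of n 3 [:: p.1.1.2; p.1.2.2; p.2.2]).
apply: (@reindex_seq _ (T * T)%type (point * point * point)%type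
  _ _ _ _ h k (fun t => F t.2)).
- exact: index_enum_uniq.
- exact: pts3_uniq.
- case=> u v _; rewrite /h /k /=.
  rewrite !forall_ord_recl !forall_ord0 !big_ord_recl big_ord0 /=.
  rewrite ?andbT addn0 addnA /desc3 /area mem_pts3 mem_pts2 !mem_pts /= -!andbA.
  case/and5P=> u0 u1 u2 lt_10 /and5P[_ lt_21 v0 v1 /andP[v2 ->]].
  rewrite u0 v0 u1 v1 u2 v2 lt_10 lt_21 !leq_ord; split=> //=.
  congr pair; apply: ffun_ofK => i; case: (unliftP ord0 i) => [j|] -> //;
    by case: (unliftP ord0 j) => [j'|] -> //; rewrite (ord1 j').
case=> [[[u1 v1] [u2 v2]] [u3 v3]].
rewrite mem_pts3 mem_pts2 !mem_pts /h /k /desc3 /area /= => /andP[].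
case/andP=> /andP[/andP[u1_gt0 leu1] /andP[v1_gt0 lev1]].
case/andP=> /andP[u2_gt0 leu2] /andP[v2_gt0 lev2].
case/andP=> /andP[u3_gt0 leu3] /andP[v3_gt0 lev3] /and3P[lt_32 lt_21 Dn].
rewrite !forall_ord_recl !forall_ord0 !big_ord_recl big_ord0 /=.
rewrite mem_index_enum !ffun_ofE //= u1_gt0 u2_gt0 u3_gt0 v1_gt0 v2_gt0 v3_gt0.
by rewrite lt_32 lt_21 (ltn_trans lt_32 lt_21) addn0 addnA Dn.
Qed.

(** * Brackets cleared of their factorial denominators *)

Definition wfact (s : seq nat) : nat := (\prod_(x <- s) (x.-1)`!)%N.

Lemma wfact_neq0 (s : seq nat) : (wfact s)%:R != 0 :> rat.
Proof.
rewrite /wfact natr_prod prodf_seq_neq0; apply/allP => x _.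
by rewrite pnatr_eq0 -lt0n fact_gt0.
Qed.

Lemma wfact_bracket (s : seq nat) n :
  (0 < n)%N ->
  (wfact s)%:R * bracket s n = (sigma [seq x.-1 | x <- s] n)%:R.
Proof. by move=> n_gt0; rewrite /bracket n_gt0 mulVKf ?wfact_neq0. Qed.

(** The constant coefficient agrees as well: [bracket] is 0 there by definition and [pts 0] is
    empty. *)
Lemma wfact_bracket1 a n :
  (wfact [:: a])%:R * bracket [:: a] n = sum1 n (fun u v => v%:R ^+ a.-1).
Proof.
case: n => [|n]; first by rewrite /sum1 big_nil mulr0.
by rewrite wfact_bracket // sigma_sum1.
Qed.

Lemma wfact_bracket2 a b n :
  (wfact [:: a; b])%:R * bracket [:: a; b] n =
    sum2 n (fun u1 v1 u2 v2 => v1%:R ^+ a.-1 * v2%:R ^+ b.-1).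
Proof.
case: n => [|n]; first by rewrite /sum2 big_nil mulr0.
by rewrite wfact_bracket // sigma_sum2.
Qed.

Lemma wfact_bracket3 a b c n :
  (wfact [:: a; b; c])%:R * bracket [:: a; b; c] n =
    sum3 n (fun u1 v1 u2 v2 u3 v3 =>
      v1%:R ^+ a.-1 * (v2%:R ^+ b.-1 * v3%:R ^+ c.-1)).
Proof.
case: n => [|n]; first by rewrite /sum3 big_nil mulr0.
by rewrite wfact_bracket // sigma_sum3.
Qed.

(* An entry [(s, q)] stands for [q] times the bracket of [s] without its
   factorial denominator, which keeps all coefficients integral. *)
Definition table := seq (seq nat * rat).

Definition comb (Z : table) : qseries :=
  \sum_(x <- Z) (x.2 * (wfact x.1)%:R) *: bracket x.1.

(** The test function whose [sum1] is the length-one part of [comb Z]; [poly2] and [poly3] do the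
    same for lengths two and three. *)
Fixpoint poly1 (Z : table) (u v : rat) : rat :=
  match Z with
  | ([:: a], q) :: Z' => q * v ^+ a.-1 + poly1 Z' u v
  | _ :: Z' => poly1 Z' u v
  | [::] => 0
  end.

Fixpoint poly2 (Z : table) (u1 v1 u2 v2 : rat) : rat :=
  match Z with
  | ([:: a; b], q) :: Z' =>
      q * (v1 ^+ a.-1 * v2 ^+ b.-1) + poly2 Z' u1 v1 u2 v2
  | _ :: Z' => poly2 Z' u1 v1 u2 v2
  | [::] => 0
  end.

Fixpoint poly3 (Z : table) (u1 v1 u2 v2 u3 v3 : rat) : rat :=
  match Z with
  | ([:: a; b; c], q) :: Z' =>
      q * (v1 ^+ a.-1 * (v2 ^+ b.-1 * v3 ^+ c.-1))
      + poly3 Z' u1 v1 u2 v2 u3 v3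
  | _ :: Z' => poly3 Z' u1 v1 u2 v2 u3 v3
  | [::] => 0
  end.

Lemma comb_sums (Z : table) n :
  all (fun x => 0 < size x.1 <= 3)%N Z ->
  comb Z n =
    sum1 n (fun u v => poly1 Z u%:R v%:R)
    + sum2 n (fun u1 v1 u2 v2 => poly2 Z u1%:R v1%:R u2%:R v2%:R)
    + sum3 n (fun u1 v1 u2 v2 u3 v3 =>
        poly3 Z u1%:R v1%:R u2%:R v2%:R u3%:R v3%:R).
Proof.
elim: Z => [_|[s q] Z IH /= /andP[sz_s /IH{}IH]].
  by rewrite /comb /sum1 /sum2 /sum3 big_nil !big1 ?addr0.
have -> : comb ((s, q) :: Z) n = q * ((wfact s)%:R * bracket s n) + comb Z n.
  by rewrite /comb big_cons mulrA.
rewrite {}IH; case: s sz_s => [|a [|b [|c [|? ?]]]] // _.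
- by rewrite wfact_bracket1 /sum1 mulr_sumr !addrA -big_split.
- rewrite wfact_bracket2 /sum2 mulr_sumr addrA; congr (_ + _).
  by rewrite addrCA; congr (_ + _); rewrite -big_split.
rewrite wfact_bracket3 /sum3 mulr_sumr addrCA; congr (_ + _).
by rewrite -big_split.
Qed.

(** * Double shuffle certificates *)

(** [H] is a discrete antiderivative, so the sum telescopes. For [v = 1] both sides vanish; for
    [v = 0] the right side would be $H(0) - H(1)$. *)
Lemma sum_telescope (R : pzRingType) (F : R -> R -> R) (H : R -> R) (v : nat) :
  (0 < v)%N ->
  (forall x, F x (v%:R - x) = H (x + 1) - H x) ->
  \sum_(1 <= x < v) F x%:R (v - x)%:R = H v%:R - H 1.
Proof.
move=> v0 dH; have := telescope_sumr (fun k => H k%:R) v0.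
rewrite mulr1n => <-; apply: eq_big_nat => x /andP[_ lt_xv].
by rewrite natrB 1?ltnW // dH -natr1.
Qed.

Section Certificate.
Local Notation R := rat.

(* Each polynomial is the test function of one identity: [C1], [C2], [C3] of the
   conjugation invariance in lengths 1, 2, 3; [A] and [B] of conjugating the
   first factor of a product of lengths 1 x 1 and 1 x 2; [D] of conjugating the
   second factor in length 1 x 2. Coinciding first coordinates leave inner sums
   over [0 < x < v], which the discrete antiderivatives [H1], [H2], [H3]
   evaluate. Concrete certificates come from linear algebra on monomials. *)
Variables (C1 : R -> R -> R) (C2 A : R -> R -> R -> R -> R).
Variables C3 B D : R -> R -> R -> R -> R -> R -> R.
Variables (H1 : R -> R -> R -> R) (H2 H3 : R -> R -> R -> R -> R -> R).
Variable Z : table.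

(** Test functions minus their conjugates: the sums [prod11] and [prod12] of the defects vanish, and
    splitting these sums yields the relations. Rational and truncated [c - e] agree there, since
    [e < c] in [prod12]. *)
Definition defect11 a b c d : R := A a b c d - A b a c d.
Definition defect12 a b c d e g : R :=
  B a b c d e g - B b a c d e g
  + (D a b c d e g - D a b (d + g) e d (c - e)).

Hypothesis dH1 : forall u v x,
  defect11 u x u (v - x) = H1 u v (x + 1) - H1 u v x.
Hypothesis dH2 : forall u1 v1 u2 v2 x,
  defect12 u1 x u1 (v1 - x) u2 v2
  = H2 u1 v1 u2 v2 (x + 1) - H2 u1 v1 u2 v2 x.
Hypothesis dH3 : forall u1 v1 u2 v2 x,
  defect12 u2 x u1 v1 u2 (v2 - x)
  = H3 u1 v1 u2 v2 (x + 1) - H3 u1 v1 u2 v2 x.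

Hypothesis size_Z : all (fun x => 0 < size x.1 <= 3)%N Z.
(** Each length collects its conjugation defect, the strictly ordered terms of the split products,
    and the boundary values of the antiderivatives coming from collisions one length higher. *)
Hypothesis poly1E : forall u v,
  poly1 Z u v = C1 u v - C1 v u + (H1 u v v - H1 u v 1).
Hypothesis poly2E : forall u1 v1 u2 v2,
  poly2 Z u1 v1 u2 v2 =
    C2 u1 v1 u2 v2 - C2 (v1 + v2) u2 v1 (u1 - u2)
    + (defect11 u1 v1 u2 v2 + defect11 u2 v2 u1 v1)
    + (H2 u1 v1 u2 v2 v1 - H2 u1 v1 u2 v2 1)
    + (H3 u1 v1 u2 v2 v2 - H3 u1 v1 u2 v2 1).
Hypothesis poly3E : forall u1 v1 u2 v2 u3 v3,
  poly3 Z u1 v1 u2 v2 u3 v3 =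
    C3 u1 v1 u2 v2 u3 v3
    - C3 (v1 + v2 + v3) u3 (v1 + v2) (u2 - u3) v1 (u1 - u2)
    + (defect12 u1 v1 u2 v2 u3 v3 + defect12 u2 v2 u1 v1 u3 v3
       + defect12 u3 v3 u1 v1 u2 v2).

Let c1 (f : R -> R -> R) (u v : nat) : R := f u%:R v%:R.
Let c2 (f : R -> R -> R -> R -> R) (a b c d : nat) : R :=
  f a%:R b%:R c%:R d%:R.
Let c3 (f : R -> R -> R -> R -> R -> R -> R) (a b c d e g : nat) : R :=
  f a%:R b%:R c%:R d%:R e%:R g%:R.

(** Each coefficient of [comb Z] becomes a combination of sums of test functions and of their
    conjugates, which cancel by the conjugation and splitting identities. *)
Lemma double_shuffle_comb : comb Z = 0.
Proof.
apply/funext => n; rewrite comb_sums //.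
suff: sum1 n (c1 (poly1 Z)) + sum2 n (c2 (poly2 Z)) + sum3 n (c3 (poly3 Z))
  = 0 by [].
(* In [T1] and [T2] the telescoping is read backwards: differences of antiderivatives are turned
   back into the inner sums of the split products. *)
have T1 : sum1 n (c1 (poly1 Z)) =
   (sum1 n (c1 C1) - sum1 n (fun u v => c1 C1 v u))
   + (sum1 n (fun u v => \sum_(1 <= x < v) c2 A u x u (v - x)%N)
      - sum1 n (fun u v => \sum_(1 <= x < v) c2 A x u u (v - x)%N)).
  rewrite /sum1 -!sumrB -big_split big_seq_cond [RHS]big_seq_cond.
  apply: eq_bigr => -[u v] /=; rewrite mem_pts => /andP[/andP[_ /andP[v0 _]] _].
  rewrite -sumrB /c1 poly1E; congr (_ + _).
  by rewrite -(sum_telescope (F := fun x y => defect11 u%:R x u%:R y) v0).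
have T2 : sum2 n (c2 (poly2 Z)) =
   (sum2 n (c2 C2)
    - sum2 n (fun u1 v1 u2 v2 => c2 C2 (v1 + v2) u2 v1 (u1 - u2))%N)
   + ((sum2 n (c2 A) - sum2 n (fun a b c d => c2 A b a c d))
      + (sum2 n (fun u1 v1 u2 v2 => c2 A u2 v2 u1 v1)
         - sum2 n (fun u1 v1 u2 v2 => c2 A v2 u2 u1 v1)))
   + ((sum2 n (fun u1 v1 u2 v2 =>
         \sum_(1 <= x < v1) c3 B u1 x u1 (v1 - x)%N u2 v2)
       - sum2 n (fun u1 v1 u2 v2 =>
         \sum_(1 <= x < v1) c3 B x u1 u1 (v1 - x)%N u2 v2))
      + (sum2 n (fun u1 v1 u2 v2 =>
         \sum_(1 <= x < v1) c3 D u1 x u1 (v1 - x)%N u2 v2)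
       - sum2 n (fun u1 v1 u2 v2 => \sum_(1 <= x < v1)
           c3 D u1 x (v1 - x + v2)%N u2 (v1 - x)%N (u1 - u2)%N)))
   + ((sum2 n (fun u1 v1 u2 v2 =>
         \sum_(1 <= x < v2) c3 B u2 x u1 v1 u2 (v2 - x)%N)
       - sum2 n (fun u1 v1 u2 v2 =>
         \sum_(1 <= x < v2) c3 B x u2 u1 v1 u2 (v2 - x)%N))
      + (sum2 n (fun u1 v1 u2 v2 =>
         \sum_(1 <= x < v2) c3 D u2 x u1 v1 u2 (v2 - x)%N)
       - sum2 n (fun u1 v1 u2 v2 => \sum_(1 <= x < v2)
           c3 D u2 x (v1 + (v2 - x))%N u2 v1 (u1 - u2)%N))).
  rewrite /sum2 -!sumrB -!big_split big_seq_cond [RHS]big_seq_cond.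
  apply: eq_bigr => -[[u1 v1] [u2 v2]]; rewrite mem_pts2 !mem_pts /desc2 /=.
  move=> /andP[/andP[/andP[_ /andP[v1_gt0 _]] /andP[_ /andP[v2_gt0 _]]]].
  (* Descent makes the truncated [u1 - u2] agree with the rational difference. *)
  case/andP=> lt_u _; have le_u := ltnW lt_u.
  rewrite -!sumrB -!big_split /c2 poly2E natrB // natrD /=.
  congr (_ + _ + _ + _).
    rewrite -(sum_telescope
      (F := fun x y => defect12 u1%:R x u1%:R y u2%:R v2%:R) v1_gt0) //.
    by apply: eq_bigr => x _; rewrite /c3 (natrB _ le_u) natrD.
  rewrite -(sum_telescope
    (F := fun x y => defect12 u2%:R x u1%:R v1%:R u2%:R y) v2_gt0) //.
  by apply: eq_bigr => x _; rewrite /c3 (natrB _ le_u) natrD.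
have T3 : sum3 n (c3 (poly3 Z)) =
   (sum3 n (c3 C3)
    - sum3 n (fun u1 v1 u2 v2 u3 v3 =>
        c3 C3 (v1 + v2 + v3) u3 (v1 + v2) (u2 - u3) v1 (u1 - u2))%N)
   + (((sum3 n (c3 B) - sum3 n (fun a b c d e g => c3 B b a c d e g))
       + (sum3 n (c3 D) - sum3 n (fun a b c d e g =>
           c3 D a b (d + g) e d (c - e))%N))
    + ((sum3 n (fun u1 v1 u2 v2 u3 v3 => c3 B u2 v2 u1 v1 u3 v3)
        - sum3 n (fun u1 v1 u2 v2 u3 v3 => c3 B v2 u2 u1 v1 u3 v3))
       + (sum3 n (fun u1 v1 u2 v2 u3 v3 => c3 D u2 v2 u1 v1 u3 v3)
        - sum3 n (fun u1 v1 u2 v2 u3 v3 =>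
           c3 D u2 v2 (v1 + v3) u3 v1 (u1 - u3))%N))
    + ((sum3 n (fun u1 v1 u2 v2 u3 v3 => c3 B u3 v3 u1 v1 u2 v2)
        - sum3 n (fun u1 v1 u2 v2 u3 v3 => c3 B v3 u3 u1 v1 u2 v2))
       + (sum3 n (fun u1 v1 u2 v2 u3 v3 => c3 D u3 v3 u1 v1 u2 v2)
        - sum3 n (fun u1 v1 u2 v2 u3 v3 =>
           c3 D u3 v3 (v1 + v2) u2 v1 (u1 - u2))%N))).
  rewrite /sum3 -!sumrB -!big_split.
  apply: eq_bigr => -[[[u1 v1] [u2 v2]] [u3 v3]]; rewrite /desc3 /=.
  case/and3P=> lt_32 lt_21 _; rewrite /c3 poly3E !natrD !natrB 1?ltnW //.
  exact: ltn_trans lt_21.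
(* Each product is split both before and after conjugating a factor, and the two expansions are
   equated. *)
have EA := prod11_split n (c2 A).
rewrite prod11_conj prod11_split in EA.
have EB := prod12_split n (c3 B).
rewrite prod12_conj1 prod12_split in EB.
have ED := prod12_split n (c3 D).
rewrite prod12_conj2 prod12_split in ED.
have EC1 := sum1_conj n (c1 C1).
have EC2 := sum2_conj n (c2 C2).
have EC3 := sum3_conj n (c3 C3).
(* Each equation is solved for its leading sum; after substitution the remaining sums are atoms for
   [ring]. *)
move: EA => /esym/(canRL (addrK _))/(canRL (addrK _)) EA.
move: EB => /esym/(canRL (addrK _)) EB.
move: ED => /esym/(canRL (addrK _)) ED.
rewrite {}T1 {}T2 {}T3 EA EB ED EC1 EC2 EC3; ring.
Qed.
End Certificate.

(** * Relations in the associated graded space *)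

Section Relation.
Variables k l : nat.

Definition top_index (s : seq nat) : bool :=
  [&& admissible s, sumn s == k & size s == l].

(** The indices of the brackets among the generators of the subspace divided out in [gr k l]. *)
Definition lower_index (s : seq nat) : bool :=
  [&& admissible s, (sumn s <= k)%N, (size s <= l)%N &
      (sumn s < k)%N || (size s < l)%N].

(** The factor [wfact] converts table entries into coefficients of the normalised brackets. *)
Definition coef (T : table) : coefs k l :=
  [ffun s => \sum_(x <- T | x.1 == index_seq s) x.2 * (wfact x.1)%:R].

Lemma index_seq_inj : injective (@index_seq k l).
Proof. by move=> s t /(inj_map val_inj) eq_st; do 2!apply: val_inj. Qed.

Lemma leq_sumn (s : seq nat) x : x \in s -> (x <= sumn s)%N.
Proof.
elim: s => //= y s IH; rewrite inE => /orP[/eqP->|/IH]; first exact: leq_addr.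
by move/leq_trans; apply; apply: leq_addl.
Qed.

Lemma index_seqP (s : seq nat) :
  top_index s -> exists t : adm_index k l, index_seq t = s.
Proof.
case/and3P=> adm_s /eqP sum_s /eqP size_s.
have val_s : map val [seq inord x : 'I_k.+1 | x <- s] = s.
  rewrite -map_comp -[RHS]map_id; apply/eq_in_map => x /leq_sumn.
  by rewrite sum_s /= => le_xk; rewrite inordK.
have size_t : size [seq inord x : 'I_k.+1 | x <- s] == l.
  by rewrite size_map size_s.
have adm_t : admissible (map val (Tuple size_t))
  && (sumn (map val (Tuple size_t)) == k) by rewrite val_s adm_s sum_s eqxx.
by exists (exist _ (Tuple size_t) adm_t).
Qed.

(** After exchanging the sums, each table entry meets exactly one index, by existence and
    injectivity of [index_seq]. *)
Lemma coef_bracket (T : table) :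
  all (fun x => top_index x.1) T ->
  \sum_(s : adm_index k l) coef T s *: bracket (index_seq s) = comb T.
Proof.
move=> topT; pose F x s := (x.2 * (wfact x.1)%:R) *: bracket s : qseries.
transitivity (\sum_(s : adm_index k l)
    \sum_(x <- T | x.1 == index_seq s) F x (index_seq s)).
  by apply: eq_bigr => s _; rewrite ffunE scaler_suml.
rewrite (exchange_big_dep predT) //= /comb big_seq_cond [RHS]big_seq_cond.
apply: eq_bigr => x; rewrite andbT => /(allP topT) /index_seqP[s Ds].
rewrite (big_pred1 s) => [|t]; first by rewrite /F Ds.
by rewrite -Ds eq_sym (inj_eq index_seq_inj).
Qed.

Lemma comb_cat (T L : table) : comb (T ++ L) = comb T + comb L.
Proof. exact: big_cat. Qed.

Lemma coef_relation (T L : table) :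
  all (fun x => top_index x.1) T -> all (fun x => lower_index x.1) L ->
  comb (T ++ L) = 0 -> is_relation (coef T).
Proof.
move=> topT lowL /eqP; rewrite comb_cat addr_eq0 => /eqP DT.
rewrite /is_relation /gr_bracket.
transitivity (quot_proj (@Fil_lower k l) (\sum_(s : adm_index k l)
    coef T s *: Sub (bracket (index_seq s)) (bracket_Fil s))).
  by rewrite linear_sum; apply: eq_bigr => s _; rewrite linearZ.
apply/quot_proj_eq0/asboolP.
have -> : val (\sum_(s : adm_index k l)
    coef T s *: (Sub (bracket (index_seq s)) (bracket_Fil s) : FilT k l)) =
  - comb L.
  by rewrite -DT -(coef_bracket topT) linear_sum.
(* Entries of smaller weight go to [Fil (k - 1) l]; every other entry of [L] has smaller length and
   goes to [Fil k (l - 1)]. *)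
exists (- comb [seq x <- L | (sumn x.1 < k)%N]).
exists (- comb [seq x <- L | ~~ (sumn x.1 < k)%N]).
rewrite !rpredN -opprD; split; last first.
- congr (- _); rewrite /comb !big_filter.
  by rewrite (bigID (fun x => (sumn x.1 < k)%N)).
- rewrite /comb big_filter big_seq_cond rpred_sum // => x /andP[Lx].
  rewrite -leqNgt => le_k; apply: rpredZ; apply: span_gen; right; exists x.1.
  have /and4P[adm_x le_x _ /orP[]] := allP lowL _ Lx;
    first by rewrite ltnNge le_k.
  by move=> lt_l; split=> //; rewrite lerBrDr -PoszD addn1.
rewrite /comb big_filter big_seq_cond rpred_sum // => x /andP[Lx lt_k].
apply: rpredZ; apply: span_gen; right; exists x.1.
have /and4P[adm_x _ le_l _] := allP lowL _ Lx.
by split=> //; rewrite lerBrDr -PoszD addn1.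
Qed.

End Relation.

(** * The four relations *)

(** As [wfact [:: 3; 1; 1]] is 2, this is 72 times $[2,2,1] - 2[3,1,1]$; the scaling keeps the
    certificate integral. *)
Definition rel221_top : table :=
  [:: ([:: 2; 2; 1], 72); ([:: 3; 1; 1], - 72)].

Definition rel221_lower : table :=
  [:: ([:: 2; 1], - 12); ([:: 3; 1], 54); ([:: 3; 2], - 60); ([:: 3], 2);
      ([:: 4], - 3); ([:: 5], 1)].

(** The certificate leaves six polynomial identities. Its length-three functions are homogeneous of
    degree 2, the weight minus the length; each collision sum raises the degree by one, whence
    degrees up to 3 and 4 in lengths two and one. *)
Lemma rel221_comb : comb (rel221_top ++ rel221_lower) = 0.
Proof.
apply: (double_shuffle_comb
  (C1 := fun u v =>
    6 * u * v ^+ 3 - 9 * u * v ^+ 2 - 6 * v ^+ 3 - 9 * u ^+ 2 + 3 * u)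
  (C2 := fun u1 v1 u2 v2 =>
    - (2 * u1 ^+ 3) + 18 * u1 * v1 ^+ 2 - 10 * u1 * u2 ^+ 2
    + 2 * v1 ^+ 2 * v2 + 18 * u2 * v2 ^+ 2 - 2 * v2 ^+ 3 + 9 * u1 ^+ 2
    + 45 * u2 ^+ 2 - 18 * v2 ^+ 2 - 6 * u1 - 3 * v2)
  (A := fun u1 v1 u2 v2 =>
    18 * u1 ^+ 2 * v1 + 12 * v1 ^+ 2 * v2 - 6 * v1 * u2 ^+ 2 + 9 * v1 ^+ 2
    + 3 * u1)
  (C3 := fun _ v1 u2 v2 _ v3 =>
    36 * v1 ^+ 2 - 18 * u2 ^+ 2 + 54 * v2 ^+ 2 + 36 * v2 * v3 + 18 * v3 ^+ 2)
  (B := fun u1 _ _ v2 _ _ => - (18 * u1 ^+ 2) - 36 * u1 * v2)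
  (D := fun u1 _ u2 _ u3 _ =>
    - (36 * u1 * u3) + 18 * u2 ^+ 2 + 54 * u3 ^+ 2)
  (H1 := fun u v x =>
    6 * u ^+ 3 * x - 12 * u ^+ 2 * v * x + 12 * u ^+ 2 * x ^+ 2
    - 6 * u * x ^+ 3 + 4 * v * x ^+ 3 - 3 * x ^+ 4 - 21 * u ^+ 2 * x
    + 9 * u * x ^+ 2 - 6 * v * x ^+ 2 + 9 * x ^+ 3 + 2 * v * x - 9 * x ^+ 2
    + 3 * x)
  (H2 := fun u1 v1 u2 v2 x =>
    - (36 * u1 * u2 * x) - 72 * v1 ^+ 2 * x - 36 * v1 * v2 * x
    + 90 * v1 * x ^+ 2 + 54 * u2 ^+ 2 * x - 18 * v2 ^+ 2 * x
    + 18 * v2 * x ^+ 2 - 30 * x ^+ 3 - 90 * v1 * x - 18 * v2 * x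
    + 45 * x ^+ 2 - 15 * x)
  (H3 := fun u1 v1 _ v2 x =>
    18 * u1 ^+ 2 * x - 72 * v1 ^+ 2 * x - 36 * v1 * v2 * x
    + 36 * v1 * x ^+ 2 - 18 * v2 ^+ 2 * x + 18 * v2 * x ^+ 2 - 36 * v1 * x
    - 18 * v2 * x)) => //;
  rewrite /defect11 /defect12 /= => *; ring.
Qed.

(** This is $48[3,1,2]$. *)
Definition rel312_top : table :=
  [:: ([:: 3; 1; 2], 24)].

Definition rel312_lower : table :=
  [:: ([:: 2; 4], - 4); ([:: 3; 2], - 12); ([:: 3; 3], 12); ([:: 4; 2], 4)].

Lemma rel312_comb : comb (rel312_top ++ rel312_lower) = 0.
Proof.
apply: (double_shuffle_comb
  (C1 := fun u v =>
    u ^+ 4 * v - 2 * u ^+ 3 * v + v ^+ 4 - u * v ^+ 2 - 2 * v ^+ 3 + v ^+ 2)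
  (C2 := fun u1 v1 u2 v2 =>
    u1 ^+ 4 - 4 * u1 * v1 ^+ 3 + u2 ^+ 4 - 4 * u2 * v2 ^+ 3 - 2 * u1 ^+ 3
    + 10 * v1 ^+ 3 + 4 * v2 ^+ 3 + u1 ^+ 2 - v1 ^+ 2)
  (A := fun u1 v1 _ v2 =>
    - u1 ^+ 4 + 4 * u1 * v1 ^+ 3 - 4 * v1 ^+ 3 * v2 - 2 * v1 ^+ 3 - u1 ^+ 2)
  (C3 := fun u1 v1 u2 _ u3 _ =>
    4 * u1 ^+ 3 - 12 * u1 ^+ 2 * u3 + 12 * u1 * u3 ^+ 2 - 4 * v1 ^+ 3
    + 4 * u2 ^+ 3)
  (B := fun u1 v1 _ v2 u3 _ =>
    12 * u1 ^+ 2 * u3 - 4 * v1 ^+ 3 + 12 * v1 * v2 ^+ 2)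
  (D := fun u1 v1 u2 v2 u3 _ =>
    - (12 * u1 * u3 ^+ 2) - 12 * v1 ^+ 2 * v2 - 4 * u2 ^+ 3 - 4 * u3 ^+ 3)
  (H1 := fun u v x =>
    - (u ^+ 4 * x) + 4 * u ^+ 3 * v * x - 4 * u ^+ 3 * x ^+ 2 + u * x ^+ 4
    - v * x ^+ 4 + x ^+ 5 + 6 * u ^+ 3 * x - 2 * u * x ^+ 3 + 2 * v * x ^+ 3
    - 3 * x ^+ 4 - u ^+ 2 * x + u * x ^+ 2 - v * x ^+ 2 + 3 * x ^+ 3
    - x ^+ 2)
  (H2 := fun u1 v1 u2 v2 x =>
    12 * u1 ^+ 2 * u2 * x - 12 * u1 * u2 ^+ 2 * x + 8 * v1 ^+ 3 * x
    + 12 * v1 ^+ 2 * v2 * x - 6 * v1 ^+ 2 * x ^+ 2 + 12 * v1 * v2 ^+ 2 * x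
    - 12 * v1 * v2 * x ^+ 2 - 4 * v1 * x ^+ 3 - 4 * u2 ^+ 3 * x
    + 4 * v2 ^+ 3 * x - 6 * v2 ^+ 2 * x ^+ 2 + 4 * v2 * x ^+ 3 + 3 * x ^+ 4
    + 6 * v1 ^+ 2 * x + 12 * v1 * v2 * x + 6 * v1 * x ^+ 2 + 6 * v2 ^+ 2 * x
    - 6 * v2 * x ^+ 2 - 6 * x ^+ 3 - 2 * v1 * x + 2 * v2 * x + 3 * x ^+ 2)
  (H3 := fun u1 v1 _ v2 x =>
    - (4 * u1 ^+ 3 * x) + 8 * v1 ^+ 3 * x + 12 * v1 ^+ 2 * v2 * x
    + 12 * v1 * v2 ^+ 2 * x - 12 * v1 * v2 * x ^+ 2 + 4 * v2 ^+ 3 * x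
    - 6 * v2 ^+ 2 * x ^+ 2 + 4 * v2 * x ^+ 3 - 2 * x ^+ 4 + 12 * v1 * v2 * x
    + 6 * v2 ^+ 2 * x - 6 * v2 * x ^+ 2 + 4 * x ^+ 3 + 2 * v2 * x
    - 2 * x ^+ 2)) => //;
  rewrite /defect11 /defect12 /= => *; ring.
Qed.

(** This is 72 times $[2,3,1] + [3,2,1] - 3[2,2,2]$. *)
Definition rel321_top : table :=
  [:: ([:: 2; 2; 2], - 216); ([:: 2; 3; 1], 36); ([:: 3; 2; 1], 36)].

Definition rel321_lower : table :=
  [:: ([:: 2; 2], 42); ([:: 2; 4], 12); ([:: 3; 2], - 12);
      ([:: 3; 3], - 18); ([:: 4; 1], - 6); ([:: 3], - 2); ([:: 4], 3);
      ([:: 5], - 1)].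

Lemma rel321_comb : comb (rel321_top ++ rel321_lower) = 0.
Proof.
apply: (double_shuffle_comb
  (C1 := fun u v =>
    - (3 * u ^+ 4 * v) + 6 * u ^+ 3 * v - 3 * v ^+ 4 + 3 * u * v ^+ 2
    + 6 * v ^+ 3 - 3 * v ^+ 2)
  (C2 := fun u1 v1 u2 v2 =>
    - (3 * u1 ^+ 4) + 12 * u1 * v1 ^+ 3 - 3 * u1 * u2 ^+ 3
    - 3 * v1 ^+ 3 * v2 + 12 * u2 * v2 ^+ 3 + 2 * u1 ^+ 3 + 12 * u1 * u2 ^+ 2
    - 22 * v1 ^+ 3 - 10 * v2 ^+ 3 - 3 * u1 ^+ 2 - 3 * u2 ^+ 2)
  (A := fun u1 v1 u2 v2 =>
    3 * u1 ^+ 4 - 12 * u1 * v1 ^+ 3 + 12 * v1 ^+ 3 * v2 - 6 * u1 ^+ 2 * v2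
    + 6 * v1 * u2 ^+ 2 - 3 * v1 ^+ 2)
  (C3 := fun _ v1 u2 v2 _ v3 =>
    24 * v1 ^+ 3 - 12 * u2 ^+ 3 + 12 * v2 ^+ 3 + 12 * v3 ^+ 3)
  (B := fun _ v1 u2 _ _ _ =>
    12 * v1 ^+ 3 + 36 * v1 ^+ 2 * u2 - 36 * v1 * u2 ^+ 2)
  (D := fun _ v1 u2 _ u3 v3 =>
    - (36 * v1 ^+ 2 * u2) + 36 * v1 * u2 ^+ 2 + 24 * u3 ^+ 3 - 12 * v3 ^+ 3)
  (H1 := fun u v x =>
    3 * u ^+ 4 * x - 12 * u ^+ 3 * v * x + 12 * u ^+ 3 * x ^+ 2
    - 3 * u * x ^+ 4 + 3 * v * x ^+ 4 - 3 * x ^+ 5 - 18 * u ^+ 3 * x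
    - 6 * u ^+ 2 * v * x + 6 * u ^+ 2 * x ^+ 2 + 6 * u * x ^+ 3
    - 4 * v * x ^+ 3 + 6 * x ^+ 4 - 3 * u ^+ 2 * x - 3 * u * x ^+ 2
    - 3 * x ^+ 3 + v * x)
  (H2 := fun u1 v1 u2 v2 x =>
    - (36 * u1 ^+ 2 * u2 * x) + 36 * u1 * u2 ^+ 2 * x - 24 * v1 ^+ 3 * x
    + 18 * v1 ^+ 2 * x ^+ 2 - 36 * v1 * v2 * x ^+ 2 + 12 * v1 * x ^+ 3
    + 12 * u2 ^+ 3 * x - 12 * v2 ^+ 3 * x - 18 * v2 ^+ 2 * x ^+ 2
    + 36 * v2 * x ^+ 3 - 9 * x ^+ 4 - 18 * v1 ^+ 2 * x + 36 * v1 * v2 * x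
    - 18 * v1 * x ^+ 2 + 18 * v2 ^+ 2 * x - 54 * v2 * x ^+ 2 + 18 * x ^+ 3
    + 6 * v1 * x + 18 * v2 * x - 9 * x ^+ 2)
  (H3 := fun u1 v1 _ v2 x =>
    12 * u1 ^+ 3 * x - 24 * v1 ^+ 3 * x - 18 * v1 ^+ 2 * x ^+ 2
    - 36 * v1 * v2 * x ^+ 2 + 36 * v1 * x ^+ 3 - 12 * v2 ^+ 3 * x
    + 24 * v2 * x ^+ 3 - 12 * x ^+ 4 + 18 * v1 ^+ 2 * x + 36 * v1 * v2 * x
    - 54 * v1 * x ^+ 2 - 36 * v2 * x ^+ 2 + 24 * x ^+ 3 + 18 * v1 * x
    + 12 * v2 * x - 12 * x ^+ 2)) => //;
  rewrite /defect11 /defect12 /= => *; ring.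
Qed.

(** This is 96 times $[2,2,2] + [2,3,1] - 3[4,1,1]$. *)
Definition rel222_top : table :=
  [:: ([:: 2; 2; 2], 96); ([:: 2; 3; 1], 48); ([:: 4; 1; 1], - 48)].

Definition rel222_lower : table :=
  [:: ([:: 2; 2], - 16); ([:: 2; 3], 120); ([:: 3; 1], - 8);
      ([:: 3; 2], 48); ([:: 4; 2], - 32); ([:: 5; 1], - 4); ([:: 3], - 12);
      ([:: 4], 18); ([:: 5], - 6)].

Lemma rel222_comb : comb (rel222_top ++ rel222_lower) = 0.
Proof.
apply: (double_shuffle_comb
  (* The length-one entries come entirely from the collisions evaluated by [H1]. *)
  (C1 := fun _ _ => 0)
  (C2 := fun u1 v1 u2 v2 =>
    - (3 * u1 ^+ 2 * u2 * v2) - 9 * u1 * v1 * v2 ^+ 2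
    + 9 * v1 * u2 * v2 ^+ 2 + 3 * u2 ^+ 3 * v2 + 2 * u1 ^+ 3 + 2 * v1 ^+ 3
    + 84 * v1 * v2 ^+ 2 + 38 * v2 ^+ 3)
  (A := fun u1 v1 u2 v2 =>
    - (6 * u1 * v1 ^+ 2 * v2) + 6 * v1 ^+ 2 * u2 * v2
    - 6 * v1 * u2 ^+ 2 * v2 + 36 * u1 ^+ 3 - 36 * u1 ^+ 2 * v2
    + 36 * v1 * u2 ^+ 2)
  (C3 := fun u1 v1 u2 v2 u3 v3 =>
    - (2 * u1 ^+ 3) - 16 * u1 * u2 ^+ 2 + 16 * u1 * u2 * u3 + 6 * v1 ^+ 3
    - 4 * v1 * v2 * v3 + 8 * u2 ^+ 2 * u3 + 6 * v2 ^+ 3 + 8 * v2 ^+ 2 * v3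
    - 2 * v3 ^+ 3)
  (B := fun u1 v1 u2 v2 _ v3 =>
    6 * u1 ^+ 2 * u2 - 18 * u1 * v2 ^+ 2 + 12 * v1 * u2 ^+ 2
    - 6 * v1 * v3 ^+ 2)
  (D := fun u1 v1 u2 v2 u3 v3 =>
    6 * u1 * u2 ^+ 2 - 24 * u1 * u2 * u3 - 12 * u1 * v2 * v3
    + 6 * v1 ^+ 2 * u2 - 12 * v1 * u2 ^+ 2 + 2 * u2 ^+ 3 + 22 * u2 * u3 ^+ 2
    - 2 * v2 ^+ 2 * v3 + 2 * v3 ^+ 3)
  (H1 := fun u v x =>
    - (36 * u ^+ 2 * v * x) + 36 * u ^+ 2 * x ^+ 2 + 12 * v * x ^+ 3
    - 18 * x ^+ 4 - 36 * u ^+ 2 * x - 18 * v * x ^+ 2 + 36 * x ^+ 3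
    + 6 * v * x - 18 * x ^+ 2)
  (H2 := fun u1 v1 u2 v2 x =>
    - (6 * u1 ^+ 2 * u2 * x) + 6 * u1 * u2 ^+ 2 * x - 24 * v1 ^+ 3 * x
    - 30 * v1 ^+ 2 * v2 * x + 51 * v1 ^+ 2 * x ^+ 2 - 6 * v1 * v2 ^+ 2 * x
    + 42 * v1 * v2 * x ^+ 2 - 46 * v1 * x ^+ 3 + 6 * v2 ^+ 2 * x ^+ 2
    - 20 * v2 * x ^+ 3 + 15 * x ^+ 4 - 51 * v1 ^+ 2 * x - 42 * v1 * v2 * x
    + 69 * v1 * x ^+ 2 - 6 * v2 ^+ 2 * x + 30 * v2 * x ^+ 2 - 30 * x ^+ 3
    - 23 * v1 * x - 10 * v2 * x + 15 * x ^+ 2)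
  (H3 := fun u1 v1 u2 v2 x =>
    12 * u1 * u2 ^+ 2 * x - 24 * v1 ^+ 3 * x - 30 * v1 ^+ 2 * v2 * x
    + 30 * v1 ^+ 2 * x ^+ 2 - 6 * v1 * v2 ^+ 2 * x + 18 * v1 * v2 * x ^+ 2
    - 12 * v1 * x ^+ 3 - 12 * u2 ^+ 3 * x + 3 * v2 ^+ 2 * x ^+ 2
    - 6 * v2 * x ^+ 3 + 3 * x ^+ 4 - 30 * v1 ^+ 2 * x - 18 * v1 * v2 * x
    + 18 * v1 * x ^+ 2 - 3 * v2 ^+ 2 * x + 9 * v2 * x ^+ 2 - 6 * x ^+ 3
    - 6 * v1 * x - 3 * v2 * x + 3 * x ^+ 2)) => //;
  rewrite /defect11 /defect12 /= => *; ring.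
Qed.

Lemma wfact_coef_eq0 (b q : rat) (s : seq nat) :
  q != 0 -> b * (q * (wfact s)%:R) = 0 -> b = 0.
Proof.
move=> q_neq0 /eqP; rewrite !mulf_eq0 (negPf q_neq0) (negPf (wfact_neq0 s)).
by rewrite !orbF => /eqP.
Qed.

Theorem mainTheorem7 :
  (exists c : coefs 5 3, c <> 0 /\ is_relation c) /\
  (exists c : 3.-tuple (coefs 6 3),
     free c /\ (forall i : 'I_3, is_relation (tnth c i))).
Proof.
split.
  exists (coef 5 3 rel221_top); split; last first.
    by apply: coef_relation rel221_comb.
  have [s Ds] : exists s : adm_index 5 3, index_seq s = [:: 2; 2; 1].
    exact: index_seqP.
  (* The coefficient at $[2,2,1]$ is 72 times a nonzero factorial product. *)
  move=> /ffunP/(_ s); rewrite !ffunE Ds /rel221_top !big_cons big_nil /=.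
  by rewrite addr0 => /eqP; rewrite mulf_eq0 pnatr_eq0 (negPf (wfact_neq0 _)).
exists [tuple coef 6 3 rel312_top; coef 6 3 rel321_top; coef 6 3 rel222_top].
split; last first.
  case=> [[|[|[|//]]] ?]; rewrite (tnth_nth 0) /=.
  - by apply: coef_relation rel312_comb.
  - by apply: coef_relation rel321_comb.
  - by apply: coef_relation rel222_comb.
apply/freeP => k; rewrite !big_ord_recl big_ord0 /= addr0.
set k0 := k _; set k1 := k _; set k2 := k _ => k_eq0.
have at_index u : top_index 6 3 u ->
    k0 * \sum_(x <- rel312_top | x.1 == u) x.2 * (wfact x.1)%:R
    + (k1 * \sum_(x <- rel321_top | x.1 == u) x.2 * (wfact x.1)%:R
       + k2 * \sum_(x <- rel222_top | x.1 == u) x.2 * (wfact x.1)%:R) = 0.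
  move=> /index_seqP[s Ds]; have := congr1 (fun c : coefs 6 3 => c s) k_eq0.
  by rewrite !ffunE Ds.
(* Each of these three indices occurs in exactly one of the tables, so the linear system for [k0],
   [k1], [k2] is diagonal. *)
have := (at_index [:: 3; 1; 2] isT, at_index [:: 3; 2; 1] isT,
         at_index [:: 4; 1; 1] isT).
rewrite /rel312_top /rel321_top /rel222_top !big_cons !big_nil /=.
rewrite !(mulr0, addr0, add0r) => -[[Dk0 Dk1] Dk2].
have {}Dk0 : k0 = 0 by apply: wfact_coef_eq0 Dk0; rewrite pnatr_eq0.
have {}Dk1 : k1 = 0 by apply: wfact_coef_eq0 Dk1; rewrite pnatr_eq0.
have {}Dk2 : k2 = 0 by apply: wfact_coef_eq0 Dk2; rewrite oppr_eq0 pnatr_eq0.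
move=> i; case: (unliftP ord0 i) => [j|] -> //.
by case: (unliftP ord0 j) => [j'|] -> //; rewrite (ord1 j').
Qed.
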